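(* Let $(A,[\cdot,\cdot]_A,a_A)$ be a Lie algebroid over $M$, let $\rho:A\to\mathfrak{D}(E)$ be a representation of $A$ on a vector bundle $E\to M$, and let $T:E\to A$ be an $\mathcal{O}$-operator. Define $\cdot_E$ on $\Gamma(E)$ by $$u\cdot_E v=\rho(T(u))(v),\qquad \forall u,v\in\Gamma(E).$$ Then $(E,\cdot_E,a_E=a_A\circ T)$ is a left-symmetric algebroid, and $T$ is a base-preserving Lie algebroid homomorphism from the sub-adjacent Lie algebroid of $(E,\cdot_E,a_E)$ to $(A,[\cdot,\cdot]_A,a_A)$.
   Context: All vector bundles are over the same smooth manifold $M$; bundle maps cover the identity of $M$ and are $C^\infty(M)$-linear on sections. A left-symmetric algebra is a vector space with a bilinear product $\cdot$ such that $(x\cdot y)\cdot z-x\cdot(y\cdot z)=(y\cdot x)\cdot z-y\cdot(x\cdot z)$ for all $x,y,z$. A left-symmetric algebroid $(A,\cdot_A,a_A)$ is a vector bundle $A\to M$ with an ($\mathbb{R}$-bilinear) left-symmetric algebra structure $\cdot_A$ on $\Gamma(A)$ and a bundle map $a_A:A\to TM$ (the anchor) such that $x\cdot_A(fy)=f(x\cdot_A y)+a_A(x)(f)y$ and $(fx)\cdot_A y=f(x\cdot_A y)$ for all $f\in C^\infty(M)$, $x,y\in\Gamma(A)$. Its sub-adjacent Lie algebroid is $A$ with bracket $[x,y]_A=x\cdot_A y-y\cdot_A x$ and anchor $a_A$. A Lie algebroid $(A,[\cdot,\cdot]_A,a_A)$ is a vector bundle $A\to M$ with a Lie algebra structure on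 $\Gamma(A)$ and a bundle map $a_A:A\to TM$ such that $[x,fy]_A=f[x,y]_A+a_A(x)(f)y$. A base-preserving homomorphism $\sigma:A\to B$ of Lie algebroids is a bundle map with $a_B\circ\sigma=a_A$ and $\sigma[x,y]_A=[\sigma(x),\sigma(y)]_B$. $\mathfrak{D}(E)$ is the Lie algebroid of covariant differential operators of $E$: its sections are the $\mathbb{R}$-linear maps $\mathfrak d:\Gamma(E)\to\Gamma(E)$ for which there is a vector field $X$ (the anchor of $\mathfrak d$) with $\mathfrak d(fu)=f\mathfrak d(u)+X(f)u$; the bracket is the commutator. A representation of $A$ on $E$ is a base-preserving Lie algebroid homomorphism $\rho:A\to\mathfrak{D}(E)$. A bundle map $T:E\to A$ is an $\mathcal{O}$-operator (with respect to $\rho$) if $[T(u),T(v)]_A=T\big(\rho(T(u))(v)-\rho(T(v))(u)\big)$ for all $u,v\in\Gamma(E)$. *)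

(* Defs.v *)
From HB Require Import structures.
From mathcomp Require Import all_boot all_order all_algebra.
From mathcomp Require Import all_classical all_reals.
From mathcomp Require Import topology normedtype derive.
From mathcomp Require Import ring.

Set Implicit Arguments.
Unset Strict Implicit.
Unset Printing Implicit Defensive.

Import Order.TTheory GRing.Theory Num.Theory.
Import numFieldNormedType.Exports.
Local Open Scope classical_set_scope.
Local Open Scope ring_scope.

Fixpoint Ck (R : realType) (n : nat) (U : set 'rV[R]_n) (k : nat)
    (f : 'rV[R]_n -> R) : Prop :=
  (forall x, U x -> {for x, continuous f}) /\
  (if k is k'.+1 then
     forall i : 'I_n,
       (forall x, U x -> derivable f x (delta_mx 0 i)) /\
       Ck U k' ('D_(delta_mx 0 i) f)
   else True).

Definition Coo (R : realType) (n : nat) (U : set 'rV[R]_n)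
  (f : 'rV[R]_n -> R) : Prop := forall k, Ck U k f.

Section CooTheory.
Context {R : realType} {n : nat}.
Implicit Types (U : set 'rV[R]_n) (f g : 'rV[R]_n -> R).

Lemma continuous_at_near_eq f g (x : 'rV[R]_n) :
  (\forall y \near x, f y = g y) ->
  {for x, continuous f} -> {for x, continuous g}.
Proof.
move=> fg cf; rewrite /prop_for /continuous_at -(nbhs_singleton fg).
exact: cvg_trans (near_eq_cvg fg) cf.
Qed.

Lemma Ck_eq U k f g : open U -> (forall x, U x -> f x = g x) ->
  Ck U k f -> Ck U k g.
Proof.
move=> oU; elim: k f g => [|k IH] f g fg /= [cf df].
all: have nfg x : U x -> \forall y \near x, f y = g y
  by move=> Ux; near=> y; apply: fg; near: y; apply: open_nbhs_nbhs.
  by split=> // x Ux; exact: continuous_at_near_eq (nfg x Ux) (cf x Ux).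
split=> [x Ux|]; first exact: continuous_at_near_eq (nfg x Ux) (cf x Ux).
move=> i; have [dfi Ckf] := df i.
split=> [x Ux|]; first exact: near_eq_derivable (nfg x Ux) (dfi x Ux).
by apply: IH Ckf => x Ux; exact: near_eq_derive (nfg x Ux).
Unshelve. all: by end_near. Qed.

Lemma Ck_le U k f : Ck U k.+1 f -> Ck U k f.
Proof.
elim: k f => [|k IH] f [cf df]; first by split.
by split=> // i; have [dfi /IH] := df i.
Qed.

Lemma Ck_cst U k (c : R) : Ck U k (fun=> c).
Proof.
elim: k c => [|k IH] c; split=> //; try by move=> x _; exact: cst_continuous.
move=> i; split=> [x _|]; first exact: derivable_cst.
rewrite (_ : 'D_(delta_mx 0 i) _ = fun=> 0); first exact: IH.
by apply/funext => x; rewrite derive_cst.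
Qed.

Lemma CkD U k f g : open U -> Ck U k f -> Ck U k g ->
  Ck U k (fun x => f x + g x).
Proof.
move=> oU; elim: k f g => [|k IH] f g [cf df] [cg dg]; split=> //;
  try by move=> x Ux; exact: cvgD (cf x Ux) (cg x Ux).
move=> i; have [dfi Cf] := df i; have [dgi Cg] := dg i.
split=> [x Ux|]; first by apply: derivableD; [exact: dfi|exact: dgi].
apply: Ck_eq (IH _ _ Cf Cg) => // x Ux.
by rewrite -deriveD//; [exact: dfi|exact: dgi].
Qed.

Lemma CkM U k f g : open U -> Ck U k f -> Ck U k g ->
  Ck U k (fun x => f x * g x).
Proof.
move=> oU; elim: k f g => [|k IH] f g Cf Cg;
  have [cf df] := Cf; have [cg dg] := Cg; split=> //;
  try by move=> x Ux; exact: cvgM (cf x Ux) (cg x Ux).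
move=> i; have [dfi Cfi] := df i; have [dgi Cgi] := dg i.
split=> [x Ux|]; first by apply: derivableM; [exact: dfi|exact: dgi].
apply: Ck_eq (CkD oU (IH _ _ (Ck_le Cf) Cgi) (IH _ _ (Ck_le Cg) Cfi)) => //.
by move=> x Ux; rewrite deriveM//; [exact: dfi|exact: dgi].
Qed.

End CooTheory.

(* [cmap] and [cinv] are total functions; their values outside the open sets
   [cdom] and [ccod] are irrelevant. *)
Record chart (R : realType) (M : topologicalType) (n : nat) := Chart {
  cdom : set M;
  ccod : set 'rV[R]_n;
  cmap : M -> 'rV[R]_n;
  cinv : 'rV[R]_n -> M;
  cdom_open : open cdom;
  ccod_open : open ccod;
  cmap_cod : forall p, cdom p -> ccod (cmap p);
  cinv_dom : forall y, ccod y -> cdom (cinv y);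
  cmapK : forall p, cdom p -> cinv (cmap p) = p;
  cinvK : forall y, ccod y -> cmap (cinv y) = y;
  cmap_continuous : forall p, cdom p -> {for p, continuous cmap};
  cinv_continuous : forall y, ccod y -> {for y, continuous cinv}
}.

Record smoothManifold (R : realType) := SmoothManifold {
  carrier :> topologicalType;
  mdim : nat;
  atlas : set (chart R carrier mdim);
  manifold_hausdorff : hausdorff_space carrier;
  manifold_second_countable : @second_countable carrier;
  atlas_cover : forall p, exists2 c, atlas c & cdom c p;
  atlas_compat : forall c d, atlas c -> atlas d -> forall j,
    Coo (ccod c `&` cinv c @^-1` cdom d) (fun y => cmap d (cinv c y) 0 j)
}.

Definition smooth_on (R : realType) (M : smoothManifold R) (W : set M)
    (f : M -> R) : Prop :=
  forall c, atlas c -> Coo (ccod c `&` cinv c @^-1` W) (f \o cinv c).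

Section SmoothOn.
Context {R : realType} {M : smoothManifold R}.
Implicit Types (W : set M) (f g : M -> R).

Lemma chart_preimage_open (c : chart R M (mdim M)) W :
  open W -> open (ccod c `&` cinv c @^-1` W).
Proof.
move=> oW; rewrite openE => y [cy Wy].
have nc : nbhs y (ccod c) by apply: open_nbhs_nbhs; split=> //; exact: ccod_open.
have nW : nbhs (cinv c y) W by exact: open_nbhs_nbhs.
exact: filterI nc (cinv_continuous cy nW).
Qed.

Lemma smooth_on_eq W f g : open W -> (forall p, W p -> f p = g p) ->
  smooth_on W f -> smooth_on W g.
Proof.
move=> oW fg sf c ac k; apply: Ck_eq (sf c ac k).
  exact: chart_preimage_open.
by move=> y [_ Wy] /=; exact: fg.
Qed.

Lemma smooth_on_cst W (a : R) : smooth_on W (fun=> a).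
Proof. by move=> c ac k; exact: Ck_cst. Qed.

Lemma smooth_onD W f g : open W -> smooth_on W f -> smooth_on W g ->
  smooth_on W (fun p => f p + g p).
Proof.
by move=> oW sf sg c ac k; apply: CkD (sf c ac k) (sg c ac k);
   exact: chart_preimage_open.
Qed.

Lemma smooth_onM W f g : open W -> smooth_on W f -> smooth_on W g ->
  smooth_on W (fun p => f p * g p).
Proof.
by move=> oW sf sg c ac k; apply: CkM (sf c ac k) (sg c ac k);
   exact: chart_preimage_open.
Qed.

Lemma smooth_onS W W' f : W `<=` W' -> smooth_on W' f -> smooth_on W f.
Proof.
move=> WW' sf c ac k; move: (sf c ac k).
move: (f \o cinv c); elim: k => [|k IH] h [ch dh]; split=> //;
  try by move=> y [cy Wy]; apply: ch; split=> //; exact: WW'.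
move=> i; have [dhi Chi] := dh i; split; last exact: IH.
by move=> y [cy Wy]; apply: dhi; split=> //; exact: WW'.
Qed.

End SmoothOn.

Record Cinf (R : realType) (M : smoothManifold R) := MkCinf {
  cinf_fun :> M -> R;
  cinf_smooth : smooth_on setT cinf_fun
}.

Section CinfAlgebra.
Context {R : realType} {M : smoothManifold R}.
Implicit Types f g h : Cinf M.

Lemma cinf_ext f g : (forall p, f p = g p) -> f = g.
Proof.
case: f g => [f sf] [g sg] /= /funext fg; subst g.
by congr MkCinf; exact: Prop_irrelevance.
Qed.

Definition cinf_cst (a : R) : Cinf M := MkCinf (smooth_on_cst setT a).
Definition cinf_add f g : Cinf M :=
  MkCinf (smooth_onD openT (cinf_smooth f) (cinf_smooth g)).
Definition cinf_mul f g : Cinf M :=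
  MkCinf (smooth_onM openT (cinf_smooth f) (cinf_smooth g)).

HB.instance Definition _ := gen_eqMixin (Cinf M).
HB.instance Definition _ := gen_choiceMixin (Cinf M).

Program Definition cinf_zmod := @GRing.isZmodule.Build (Cinf M)
  (cinf_cst 0) (cinf_mul (cinf_cst (-1))) cinf_add _ _ _ _.
Next Obligation. by move=> f g h; apply: cinf_ext => p; rewrite /= addrA. Qed.
Next Obligation. by move=> f g; apply: cinf_ext => p; rewrite /= addrC. Qed.
Next Obligation. by move=> f; apply: cinf_ext => p; rewrite /= add0r. Qed.
Next Obligation.
by move=> f; apply: cinf_ext => p; rewrite /= mulN1r addNr.
Qed.
HB.instance Definition _ := cinf_zmod.

Program Definition cinf_ring := @GRing.Zmodule_isComPzRing.Build (Cinf M)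
  (cinf_cst 1) cinf_mul _ _ _ _.
Next Obligation. by move=> f g h; apply: cinf_ext => p; rewrite /= mulrA. Qed.
Next Obligation. by move=> f g; apply: cinf_ext => p; rewrite /= mulrC. Qed.
Next Obligation. by move=> f; apply: cinf_ext => p; rewrite /= mul1r. Qed.
Next Obligation. by move=> f g h; apply: cinf_ext => p; rewrite /= mulrDl. Qed.
HB.instance Definition _ := cinf_ring.

Program Definition cinf_lmod := @GRing.Zmodule_isLmodule.Build R (Cinf M)
  (fun a f => cinf_mul (cinf_cst a) f) _ _ _ _.
Next Obligation.
by move=> a b f; apply: cinf_ext => p; rewrite /= mulrA.
Qed.
Next Obligation. by move=> f; apply: cinf_ext => p; rewrite /= mul1r. Qed.
Next Obligation.
by move=> a f g; apply: cinf_ext => p; rewrite /= mulrDr.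
Qed.
Next Obligation.
by move=> f a b; apply: cinf_ext => p; rewrite /= mulrDl.
Qed.
HB.instance Definition _ := cinf_lmod.

End CinfAlgebra.

(* A family of real vector spaces over M, together with a C^oo(M)-submodule
   of smooth sections. Vector bundles, the tangent bundle (with fibres the
   point derivations) and the bundle D(E) of covariant differential operators
   are all presented as such families, so that bundle maps have a single
   definition. *)
Record smoothFamily (R : realType) (M : smoothManifold R) := SmoothFamily {
  fiber :> M -> lmodType R;
  smooth_sec : (forall p, fiber p) -> Prop;
  smooth_sec0 : smooth_sec (fun=> 0);
  smooth_secD : forall u v, smooth_sec u -> smooth_sec v ->
    smooth_sec (fun p => u p + v p);
  smooth_secZ : forall (f : Cinf M) u, smooth_sec u ->
    smooth_sec (fun p => f p *: u p)
}.

Record section (R : realType) (M : smoothManifold R) (F : smoothFamily M) :=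
  MkSection {
    sec_fun :> forall p, fiber F p;
    sec_smooth : smooth_sec sec_fun
  }.

Section SectionModule.
Context {R : realType} {M : smoothManifold R} {F : smoothFamily M}.
Implicit Types u v w : section F.

Lemma sec_ext u v : (forall p, u p = v p) -> u = v.
Proof.
case: u v => [u su] [v sv] /= uv.
have {}uv : u = v by apply/functional_extensionality_dep.
by subst v; congr MkSection; exact: Prop_irrelevance.
Qed.

Definition fscale (f : Cinf M) u : section F :=
  MkSection (smooth_secZ f (sec_smooth u)).
Definition sec_add u v : section F :=
  MkSection (smooth_secD (sec_smooth u) (sec_smooth v)).

HB.instance Definition _ := gen_eqMixin (section F).
HB.instance Definition _ := gen_choiceMixin (section F).

Program Definition sec_zmod := @GRing.isZmodule.Build (section F)
  (MkSection (@smooth_sec0 R M F)) (fscale (cinf_cst (-1))) sec_add _ _ _ _.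
Next Obligation. by move=> u v w; apply: sec_ext => p; rewrite /= addrA. Qed.
Next Obligation. by move=> u v; apply: sec_ext => p; rewrite /= addrC. Qed.
Next Obligation. by move=> u; apply: sec_ext => p; rewrite /= add0r. Qed.
Next Obligation.
by move=> u; apply: sec_ext => p; rewrite /= scaleN1r addNr.
Qed.
HB.instance Definition _ := sec_zmod.

Program Definition sec_lmod := @GRing.Zmodule_isLmodule.Build R (section F)
  (fun a u => fscale (cinf_cst a) u) _ _ _ _.
Next Obligation.
by move=> a b u; apply: sec_ext => p; rewrite /= scalerA.
Qed.
Next Obligation. by move=> u; apply: sec_ext => p; rewrite /= scale1r. Qed.
Next Obligation.
by move=> a u v; apply: sec_ext => p; rewrite /= scalerDr.
Qed.
Next Obligation.
by move=> u a b; apply: sec_ext => p; rewrite /= scalerDl.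
Qed.
HB.instance Definition _ := sec_lmod.

Lemma sec0E p : (0 : section F) p = 0. Proof. by []. Qed.
Lemma secDE u v p : (u + v) p = u p + v p. Proof. by []. Qed.
Lemma secNE u p : (- u) p = - u p. Proof. exact: scaleN1r. Qed.
Lemma secBE u v p : (u - v) p = u p - v p.
Proof. by rewrite secDE secNE. Qed.
Lemma fscaleB (f : Cinf M) u v : fscale f (u - v) = fscale f u - fscale f v.
Proof.
apply: sec_ext => p; rewrite secBE -[LHS]/(f p *: (u - v) p).
by rewrite secBE scalerBr.
Qed.
Lemma secZE (a : R) u p : (a *: u) p = a *: u p. Proof. by []. Qed.

End SectionModule.

Notation "f *^ u" := (fscale f u) (at level 40, left associativity)
  : ring_scope.

(* A local trivialization over the open set [tdom]; [tmap] and [tinv] are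
   irrelevant outside of [tdom]. The rank is attached to the trivialization,
   hence it is only locally constant. *)
Record trivialization (R : realType) (M : smoothManifold R)
    (V : M -> lmodType R) := Trivialization {
  tdom : set M;
  trank : nat;
  tmap : forall p, V p -> 'rV[R]_trank;
  tinv : forall p, 'rV[R]_trank -> V p;
  tdom_open : open tdom;
  tmap_linear : forall p, tdom p -> linear (@tmap p);
  tmapK : forall p, tdom p -> cancel (@tmap p) (@tinv p);
  tinvK : forall p, tdom p -> cancel (@tinv p) (@tmap p)
}.

Arguments tmap {R M V} t {p} _.
Arguments tinv {R M V} t p _.

Record vectorBundle (R : realType) (M : smoothManifold R) := VectorBundle {
  vb_fiber : M -> lmodType R;
  vb_triv : set (trivialization vb_fiber);
  vb_cover : forall p, exists2 t, vb_triv t & tdom t p;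
  vb_compat : forall s t, vb_triv s -> vb_triv t -> forall i j,
    smooth_on (tdom s `&` tdom t)
      (fun p => tmap t (tinv s p (delta_mx 0 i)) 0 j)
}.

Section VectorBundleSections.
Context {R : realType} {M : smoothManifold R} (E : vectorBundle M).

Definition vb_smooth (u : forall p, vb_fiber E p) : Prop :=
  forall t, vb_triv t -> forall j,
    smooth_on (tdom t) (fun p => tmap t (u p) 0 j).

Lemma vb_smoothZD (f : Cinf M) u v : vb_smooth u -> vb_smooth v ->
  vb_smooth (fun p => f p *: u p + v p).
Proof.
move=> su sv t tE j; have ot := tdom_open t.
have sf : smooth_on (tdom t) f by exact: smooth_onS (cinf_smooth f).
apply: smooth_on_eq (smooth_onD ot (smooth_onM ot sf (su t tE j)) (sv t tE j)).
  exact: ot.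
by move=> p tp; rewrite (tmap_linear tp) !mxE.
Qed.

Lemma vb_smooth0 : vb_smooth (fun=> 0).
Proof.
move=> t tE j; apply: smooth_on_eq (smooth_on_cst (tdom t) 0).
  exact: tdom_open.
move=> p tp; have := tmap_linear tp (-1) 0 0.
by rewrite scaler0 addr0 scaleN1r addNr => ->; rewrite mxE.
Qed.

Lemma vb_smoothD u v : vb_smooth u -> vb_smooth v ->
  vb_smooth (fun p => u p + v p).
Proof.
move=> su sv; have := vb_smoothZD (cinf_cst 1) su sv.
rewrite (_ : (fun p => _) = fun p => u p + v p)//.
by apply/functional_extensionality_dep => p; rewrite scale1r.
Qed.

Lemma vb_smoothZ (f : Cinf M) u : vb_smooth u ->
  vb_smooth (fun p => f p *: u p).
Proof.
move=> su; have := vb_smoothZD f su vb_smooth0.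
rewrite (_ : (fun p => _) = fun p => f p *: u p)//.
by apply/functional_extensionality_dep => p; rewrite addr0.
Qed.

Definition vb_family : smoothFamily M :=
  SmoothFamily vb_smooth0 vb_smoothD vb_smoothZ.

End VectorBundleSections.

Coercion vb_family : vectorBundle >-> smoothFamily.

(* Tangent vectors at p are the derivations of C^oo(M) at p. *)
Record tangent (R : realType) (M : smoothManifold R) (p : M) := Tangent {
  tan_fun :> Cinf M -> R;
  tan_linear : scalar tan_fun;
  tan_leibniz : forall f g, tan_fun (f * g) = f p * tan_fun g + g p * tan_fun f
}.

Section TangentModule.
Context {R : realType} {M : smoothManifold R} {p : M}.
Implicit Types v w : tangent p.

Lemma tan_ext v w : (forall f, v f = w f) -> v = w.
Proof.
case: v w => [v lv dv] [w lw dw] /= /funext vw; subst w.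
by congr Tangent; exact: Prop_irrelevance.
Qed.

Program Definition tan_zero : tangent p := @Tangent R M p (fun=> 0) _ _.
Next Obligation. by move=> a f g; rewrite mulr0 addr0. Qed.
Next Obligation. by move=> f g; rewrite !mulr0 addr0. Qed.

Program Definition tan_add v w : tangent p :=
  @Tangent R M p (fun f => v f + w f) _ _.
Next Obligation.
by move=> v w a f g; rewrite !tan_linear mulrDr addrACA.
Qed.
Next Obligation.
by move=> v w f g; rewrite /= !tan_leibniz !mulrDr addrACA.
Qed.

Program Definition tan_scale (a : R) v : tangent p :=
  @Tangent R M p (fun f => a * v f) _ _.
Next Obligation.
by move=> a v b f g; rewrite tan_linear mulrDr mulrCA.
Qed.
Next Obligation.
by move=> a v f g; rewrite /= tan_leibniz mulrDr mulrCA (mulrCA a).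
Qed.

HB.instance Definition _ := gen_eqMixin (tangent p).
HB.instance Definition _ := gen_choiceMixin (tangent p).

Program Definition tan_zmod := @GRing.isZmodule.Build (tangent p)
  tan_zero (tan_scale (-1)) tan_add _ _ _ _.
Next Obligation. by move=> u v w; apply: tan_ext => f; rewrite /= addrA. Qed.
Next Obligation. by move=> v w; apply: tan_ext => f; rewrite /= addrC. Qed.
Next Obligation. by move=> v; apply: tan_ext => f; rewrite /= add0r. Qed.
Next Obligation.
by move=> v; apply: tan_ext => f; rewrite /= mulN1r addNr.
Qed.
HB.instance Definition _ := tan_zmod.

Program Definition tan_lmod :=
  @GRing.Zmodule_isLmodule.Build R (tangent p) tan_scale _ _ _ _.
Next Obligation. by move=> a b v; apply: tan_ext => f; rewrite /= mulrA. Qed.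
Next Obligation. by move=> v; apply: tan_ext => f; rewrite /= mul1r. Qed.
Next Obligation.
by move=> a v w; apply: tan_ext => f; rewrite /= mulrDr.
Qed.
Next Obligation.
by move=> v a b; apply: tan_ext => f; rewrite /= mulrDl.
Qed.
HB.instance Definition _ := tan_lmod.

Lemma tan0E f : (0 : tangent p) f = 0. Proof. by []. Qed.
Lemma tanDE v w f : (v + w) f = v f + w f. Proof. by []. Qed.
Lemma tanZE (a : R) v f : (a *: v) f = a * v f. Proof. by []. Qed.

End TangentModule.

Section TangentBundle.
Context {R : realType} (M : smoothManifold R).

Definition vf_smooth (X : forall p : M, tangent p) : Prop :=
  forall f : Cinf M, smooth_on setT (fun p => X p f).

Lemma vf_smooth0 : vf_smooth (fun=> 0).
Proof. by move=> f; exact: smooth_on_cst. Qed.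

Lemma vf_smoothD X Y : vf_smooth X -> vf_smooth Y ->
  vf_smooth (fun p => X p + Y p).
Proof. by move=> sX sY f; exact: smooth_onD openT (sX f) (sY f). Qed.

Lemma vf_smoothZ (f : Cinf M) X : vf_smooth X ->
  vf_smooth (fun p => f p *: X p).
Proof.
by move=> sX g; exact: smooth_onM openT (cinf_smooth f) (sX g).
Qed.

Definition tangentBundle : smoothFamily M :=
  @SmoothFamily R M (fun p => tangent p : lmodType R) vf_smooth
    vf_smooth0 vf_smoothD vf_smoothZ.

End TangentBundle.

Definition vf_app (R : realType) (M : smoothManifold R)
    (X : section (tangentBundle M)) (f : Cinf M) : Cinf M :=
  MkCinf (sec_smooth X f).

Record bundleMap (R : realType) (M : smoothManifold R)
    (F G : smoothFamily M) := BundleMap {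
  bm_fun : forall p, fiber F p -> fiber G p;
  bm_linear : forall p, linear (@bm_fun p);
  bm_smooth : forall u : section F, smooth_sec (fun p => bm_fun (u p))
}.

Definition bm_sec (R : realType) (M : smoothManifold R)
    (F G : smoothFamily M) (T : bundleMap F G) (u : section F) : section G :=
  MkSection (bm_smooth T u).

(* [T u] is the image of the section [u]; on fibres write [bm_fun T e]. *)
Coercion bm_sec : bundleMap >-> Funclass.

Lemma bm_sec_linear (R : realType) (M : smoothManifold R)
  (F G : smoothFamily M) (T : bundleMap F G) : linear T.
Proof. by move=> a u v; apply: sec_ext => p; exact: bm_linear. Qed.

Lemma bm_sec_fscale (R : realType) (M : smoothManifold R)
  (F G : smoothFamily M) (T : bundleMap F G) (f : Cinf M) (u : section F) :
  T (f *^ u) = f *^ T u.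
Proof.
apply: sec_ext => p /=; have := bm_linear T (f p) (u p) 0.
have -> : bm_fun T (0 : fiber F p) = 0.
  by have := bm_linear T (-1) (0 : fiber F p) 0; rewrite !scaleN1r !addNr.
by rewrite !addr0.
Qed.

Program Definition bm_comp (R : realType) (M : smoothManifold R)
    (F G H : smoothFamily M) (S : bundleMap G H) (T : bundleMap F G) :
    bundleMap F H :=
  @BundleMap R M F H (fun p e => bm_fun S (bm_fun T e)) _ _.
Next Obligation. by move=> R M F G H S T p a u v; rewrite !bm_linear. Qed.
Next Obligation. by move=> R M F G H S T u; exact: bm_smooth S (T u). Qed.

Definition bilinear_op (R : realType) (V : lmodType R) (m : V -> V -> V) :=
  (forall x, linear (m x)) /\ (forall y, linear (m ^~ y)).

Definition lie_law (R : realType) (V : lmodType R) (b : V -> V -> V) :=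
  [/\ bilinear_op b, forall x, b x x = 0 &
      forall x y z, b x (b y z) + b y (b z x) + b z (b x y) = 0].

Definition left_symmetric_law (R : realType) (V : lmodType R)
    (m : V -> V -> V) :=
  bilinear_op m /\
  (forall x y z, m (m x y) z - m x (m y z) = m (m y x) z - m y (m x z)).

(* Local triviality of F is not part of this record, so that D(E), given below
   by its fibres and smooth sections, is an instance. A Lie algebroid in the
   usual sense is an instance at a [vectorBundle]. *)
Record lieAlgebroid (R : realType) (M : smoothManifold R)
    (F : smoothFamily M) := LieAlgebroid {
  lie_bracket : section F -> section F -> section F;
  lie_anchor : bundleMap F (tangentBundle M);
  lie_bracketP : lie_law lie_bracket;
  lie_leibniz : forall x (f : Cinf M) y,
    lie_bracket x (f *^ y) =
    f *^ lie_bracket x y + vf_app (lie_anchor x) f *^ y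
}.

Record leftSymmetricAlgebroid (R : realType) (M : smoothManifold R)
    (F : smoothFamily M) := LeftSymmetricAlgebroid {
  ls_mul : section F -> section F -> section F;
  ls_anchor : bundleMap F (tangentBundle M);
  ls_mulP : left_symmetric_law ls_mul;
  ls_leibniz : forall x (f : Cinf M) y,
    ls_mul x (f *^ y) = f *^ ls_mul x y + vf_app (ls_anchor x) f *^ y;
  ls_linear : forall (f : Cinf M) x y, ls_mul (f *^ x) y = f *^ ls_mul x y
}.

Lemma jacobi_cancel (V : zmodType) (a b c d e f : V) :
  a - b - (c - d) + (c - e - (f - b)) + (f - d - (a - e)) = 0.
Proof.
rewrite !opprB !addrA [LHS](ACl ((1*12)*(2*7)*(3*10)*(4*5)*(6*11)*(8*9))) /=.
by rewrite !(subrr, addNr) !addr0.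
Qed.

Lemma commutator_lie_law (R : realType) (V : lmodType R) (m : V -> V -> V) :
  left_symmetric_law m -> lie_law (fun x y => m x y - m y x).
Proof.
move=> [[lr ll] ls]; split.
- split=> [x|y] a u v /=; rewrite lr ll scalerBr opprD [LHS]addrACA //.
- by move=> x; rewrite subrr.
have mB x y z : m x (y - z) = m x y - m x z.
  by rewrite addrC -scaleN1r lr scaleN1r addrC.
have Bm x y z : m (x - y) z = m x z - m y z.
  by rewrite addrC -scaleN1r ll scaleN1r addrC.
have {}ls x y z : m (m x y) z - m (m y x) z = m x (m y z) - m y (m x z).
  have /eqP := ls x y z; rewrite subr_eq => /eqP ->.
  by rewrite addrAC (addrAC _ (- _) (- _)) subrr add0r addrC.
by move=> x y z; rewrite !mB !Bm !ls; exact: jacobi_cancel.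
Qed.

Program Definition sub_adjacent (R : realType) (M : smoothManifold R)
    (F : smoothFamily M) (L : leftSymmetricAlgebroid F) : lieAlgebroid F :=
  @LieAlgebroid R M F (fun x y => ls_mul L x y - ls_mul L y x) (ls_anchor L)
    (commutator_lie_law (ls_mulP L)) _.
Next Obligation.
move=> R M F L x f y /=; rewrite ls_leibniz ls_linear addrAC; congr (_ + _).
by rewrite fscaleB.
Qed.

Definition lie_hom (R : realType) (M : smoothManifold R)
    (F G : smoothFamily M) (LF : lieAlgebroid F) (LG : lieAlgebroid G)
    (S : bundleMap F G) : Prop :=
  (forall p (e : fiber F p),
     bm_fun (lie_anchor LG) (bm_fun S e) = bm_fun (lie_anchor LF) e) /\
  (forall x y, S (lie_bracket LF x y) = lie_bracket LG (S x) (S y)).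

(* The fibre of D(E) at p: an R-linear map [cdo_op] from Gamma(E) to E_p with
   a symbol [cdo_sym] in T_p M. The symbol is kept as data since [cdo_op] only
   determines it when E_p is nonzero; for E = 0 one gets D(E) = TM. By
   [cdo_sectionP] below, smooth sections of this family are the same as
   covariant differential operators on Gamma(E). *)
Record cdoAt (R : realType) (M : smoothManifold R) (E : smoothFamily M)
    (p : M) := CdoAt {
  cdo_op : section E -> fiber E p;
  cdo_sym : tangent p;
  cdo_linear : linear cdo_op;
  cdo_leibniz : forall (f : Cinf M) u,
    cdo_op (f *^ u) = f p *: cdo_op u + cdo_sym f *: u p
}.

Section CdoModule.
Context {R : realType} {M : smoothManifold R} {E : smoothFamily M} {p : M}.
Implicit Types c d : cdoAt E p.

Lemma cdo_ext c d : (forall u, cdo_op c u = cdo_op d u) ->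
  cdo_sym c = cdo_sym d -> c = d.
Proof.
case: c d => [c X lc sc] [d Y ld sd] /= /funext cd XY; subst d Y.
by congr CdoAt; exact: Prop_irrelevance.
Qed.

Program Definition cdo_zero : cdoAt E p := @CdoAt R M E p (fun=> 0) 0 _ _.
Next Obligation. by move=> a u v; rewrite scaler0 addr0. Qed.
Next Obligation. by move=> f u; rewrite scaler0 scale0r addr0. Qed.

Program Definition cdo_add c d : cdoAt E p :=
  @CdoAt R M E p (fun u => cdo_op c u + cdo_op d u)
    (cdo_sym c + cdo_sym d) _ _.
Next Obligation.
by move=> c d a u v; rewrite !cdo_linear scalerDr addrACA.
Qed.
Next Obligation.
by move=> c d f u; rewrite /= !cdo_leibniz scalerDr scalerDl addrACA.
Qed.

Program Definition cdo_scale (a : R) c : cdoAt E p :=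
  @CdoAt R M E p (fun u => a *: cdo_op c u) (a *: cdo_sym c) _ _.
Next Obligation.
by move=> a c b u v; rewrite cdo_linear scalerDr !scalerA mulrC.
Qed.
Next Obligation.
by move=> a c f u; rewrite /= cdo_leibniz scalerDr !scalerA mulrC.
Qed.

HB.instance Definition _ := gen_eqMixin (cdoAt E p).
HB.instance Definition _ := gen_choiceMixin (cdoAt E p).

Program Definition cdo_zmod := @GRing.isZmodule.Build (cdoAt E p)
  cdo_zero (cdo_scale (-1)) cdo_add _ _ _ _.
Next Obligation. by move=> b c d; apply: cdo_ext => [u|]; rewrite /= addrA. Qed.
Next Obligation. by move=> c d; apply: cdo_ext => [u|]; rewrite /= addrC. Qed.
Next Obligation. by move=> c; apply: cdo_ext => [u|]; rewrite /= add0r. Qed.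
Next Obligation.
by move=> c; apply: cdo_ext => [u|]; rewrite /= scaleN1r addNr.
Qed.
HB.instance Definition _ := cdo_zmod.

Program Definition cdo_lmod :=
  @GRing.Zmodule_isLmodule.Build R (cdoAt E p) cdo_scale _ _ _ _.
Next Obligation.
by move=> a b c; apply: cdo_ext => [u|]; rewrite /= scalerA.
Qed.
Next Obligation. by move=> c; apply: cdo_ext => [u|]; rewrite /= scale1r. Qed.
Next Obligation.
by move=> a c d; apply: cdo_ext => [u|]; rewrite /= scalerDr.
Qed.
Next Obligation.
by move=> c a b; apply: cdo_ext => [u|]; rewrite /= scalerDl.
Qed.
HB.instance Definition _ := cdo_lmod.

End CdoModule.

Section Cdo.
Context {R : realType} {M : smoothManifold R} (E : smoothFamily M).

Definition cdo_smooth (d : forall p : M, cdoAt E p) : Prop :=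
  (forall u : section E, smooth_sec (fun p => cdo_op (d p) u)) /\
  vf_smooth (fun p => cdo_sym (d p)).

Lemma cdo_smooth0 : cdo_smooth (fun=> 0).
Proof. by split=> [u|]; [exact: smooth_sec0|exact: vf_smooth0]. Qed.

Lemma cdo_smoothD c d : cdo_smooth c -> cdo_smooth d ->
  cdo_smooth (fun p => c p + d p).
Proof.
move=> [sc tc] [sd td]; split=> [u|]; last exact: vf_smoothD.
exact: smooth_secD (sc u) (sd u).
Qed.

Lemma cdo_smoothZ (f : Cinf M) d : cdo_smooth d ->
  cdo_smooth (fun p => f p *: d p).
Proof.
move=> [sd td]; split=> [u|]; last exact: vf_smoothZ.
exact: smooth_secZ f _ (sd u).
Qed.

Definition cdoBundle : smoothFamily M :=
  @SmoothFamily R M (fun p => cdoAt E p : lmodType R) cdo_smooth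
    cdo_smooth0 cdo_smoothD cdo_smoothZ.

Definition cdo_app (d : section cdoBundle) (u : section E) : section E :=
  MkSection ((sec_smooth d).1 u).

Program Definition cdo_anchor : bundleMap cdoBundle (tangentBundle M) :=
  @BundleMap R M cdoBundle (tangentBundle M) (fun p c => cdo_sym c) _ _.
Next Obligation. by []. Qed.
Next Obligation. by move=> d; exact: (sec_smooth d).2. Qed.

Lemma cdo_app_linear (d : section cdoBundle) : linear (cdo_app d).
Proof. by move=> a u v; apply: sec_ext => p; exact: cdo_linear. Qed.

Lemma cdo_app_leibniz (d : section cdoBundle) (f : Cinf M) u :
  cdo_app d (f *^ u) = f *^ cdo_app d u + vf_app (cdo_anchor d) f *^ u.
Proof. by apply: sec_ext => p; exact: cdo_leibniz. Qed.

Lemma cdo_sectionP (d : section E -> section E)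
    (X : section (tangentBundle M)) :
  linear d ->
  (forall (f : Cinf M) u, d (f *^ u) = f *^ d u + vf_app X f *^ u) ->
  exists! s : section cdoBundle, cdo_app s = d /\ cdo_anchor s = X.
Proof.
move=> ld dd.
have lin p : linear (fun u => d u p) by move=> a u v; rewrite ld.
have lei p (f : Cinf M) u : d (f *^ u) p = f p *: d u p + X p f *: u p.
  by rewrite dd.
have sm : cdo_smooth (fun p => CdoAt (lin p) (lei p)).
  by split=> [u|]; [exact: sec_smooth (d u)|exact: sec_smooth X].
exists (@MkSection R M cdoBundle _ sm); split.
  by split; [apply/funext => u|]; apply: sec_ext.
move=> s [sd sX]; apply: sec_ext => p; apply: cdo_ext => [u|] /=.
  by rewrite -sd.
by rewrite -sX.
Qed.

End Cdo.

Section CdoBracket.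
Context {R : realType} {M : smoothManifold R} (E : smoothFamily M).
Implicit Types (X Y : section (tangentBundle M)).
Implicit Types b c d : section (cdoBundle E).

Lemma tanD (p : M) (v : tangent p) f g : v (f + g) = v f + v g.
Proof. by have := tan_linear v 1 f g; rewrite scale1r mul1r. Qed.

Lemma tanB (p : M) (v : tangent p) f g : v (f - g) = v f - v g.
Proof.
by rewrite addrC -scaleN1r tan_linear mulN1r addrC.
Qed.

Lemma vf_appD X f g : vf_app X (f + g) = vf_app X f + vf_app X g.
Proof. by apply: cinf_ext => p; exact: tanD. Qed.

Lemma vf_appM X f g :
  vf_app X (f * g) = f * vf_app X g + g * vf_app X f.
Proof. by apply: cinf_ext => p; exact: tan_leibniz. Qed.

Lemma vf_appZ X a f : vf_app X (a *: f) = a *: vf_app X f.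
Proof.
apply: cinf_ext => p /=; have := tan_linear (X p) a f 0.
have -> : X p 0 = 0 by have := tanD (X p) 0 0; rewrite addr0 => /eqP;
  rewrite eq_sym -subr_eq0 addrK => /eqP.
by rewrite !addr0.
Qed.

Program Definition vf_bracket_at X Y (p : M) : tangent p :=
  @Tangent R M p (fun f => X p (vf_app Y f) - Y p (vf_app X f)) _ _.
Next Obligation.
move=> X Y p a f g; rewrite /= !vf_appD !vf_appZ !tan_linear.
by rewrite mulrBr opprD [LHS]addrACA.
Qed.
Next Obligation.
by move=> X Y p f g; rewrite /= !vf_appM !tanD !tan_leibniz /=; ring.
Qed.

Lemma vf_bracket_smooth X Y : vf_smooth (vf_bracket_at X Y).
Proof.
move=> f; have := cinf_smooth (vf_app X (vf_app Y f) - vf_app Y (vf_app X f)).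
by apply: smooth_on_eq openT _ => p _ /=; rewrite mulN1r.
Qed.

Definition vf_bracket X Y : section (tangentBundle M) :=
  MkSection (vf_bracket_smooth X Y : @smooth_sec R M (tangentBundle M) _).

Lemma cdo_opD (p : M) (c : cdoAt E p) u v :
  cdo_op c (u + v) = cdo_op c u + cdo_op c v.
Proof. by have := cdo_linear c 1 u v; rewrite !scale1r. Qed.

Lemma cdo_opB (p : M) (c : cdoAt E p) u v :
  cdo_op c (u - v) = cdo_op c u - cdo_op c v.
Proof. by rewrite addrC -scaleN1r cdo_linear scaleN1r addrC. Qed.

Program Definition cdo_bracket_at c d (p : M) : cdoAt E p :=
  @CdoAt R M E p
    (fun u => cdo_op (c p) (cdo_app d u) - cdo_op (d p) (cdo_app c u))
    (vf_bracket_at (cdo_anchor E c) (cdo_anchor E d) p) _ _.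
Next Obligation.
move=> c d p a u v; rewrite /= !cdo_app_linear !cdo_linear.
by rewrite scalerBr opprD [LHS]addrACA.
Qed.
Next Obligation.
move=> c d p f u /=; rewrite !cdo_app_leibniz !cdo_opD !cdo_leibniz /=.
rewrite scalerBr scalerBl !opprD !addrA.
rewrite [LHS](ACl (1*5*4*8*(2*7)*(3*6))) /=.
by rewrite !subrr !addr0.
Qed.

Lemma cdo_bracket_smooth c d :
  @smooth_sec R M (cdoBundle E) (cdo_bracket_at c d).
Proof.
split=> [u|]; last exact: vf_bracket_smooth.
have := sec_smooth (cdo_app c (cdo_app d u) - cdo_app d (cdo_app c u)).
by congr smooth_sec; apply/functional_extensionality_dep => p; rewrite secBE.
Qed.

Definition cdo_bracket c d : section (cdoBundle E) :=
  MkSection (cdo_bracket_smooth c d).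

Lemma cdo_app_bracket c d u :
  cdo_app (cdo_bracket c d) u =
  cdo_app c (cdo_app d u) - cdo_app d (cdo_app c u).
Proof. by apply: sec_ext => p; rewrite secBE. Qed.

Lemma cdo_anchor_bracket c d :
  cdo_anchor E (cdo_bracket c d) =
  vf_bracket (cdo_anchor E c) (cdo_anchor E d).
Proof. exact: sec_ext. Qed.

Lemma vf_app_bracket X Y f :
  vf_app (vf_bracket X Y) f = vf_app X (vf_app Y f) - vf_app Y (vf_app X f).
Proof. by apply: cinf_ext => p /=; rewrite mulN1r. Qed.

Lemma cdo_bracketC c d : cdo_bracket c d = - cdo_bracket d c.
Proof.
apply: sec_ext => p; apply: cdo_ext => [u|].
  by rewrite secNE /= scaleN1r opprB.
by apply: tan_ext => f; rewrite secNE /= mulN1r opprB.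
Qed.

Lemma cdo_bracketP : lie_law cdo_bracket.
Proof.
have lr c : linear (cdo_bracket c).
  move=> a u v; apply: sec_ext => p; apply: cdo_ext => [w|].
    rewrite /= (_ : cdo_app (a *: u + v) w = a *: cdo_app u w + cdo_app v w);
      last exact: sec_ext.
    by rewrite cdo_linear scalerBr opprD [LHS]addrACA.
  apply: tan_ext => f /=.
  rewrite (_ : vf_app (cdo_anchor E (a *: u + v)) f =
    a *: vf_app (cdo_anchor E u) f + vf_app (cdo_anchor E v) f);
    last exact: cinf_ext.
  by rewrite tan_linear mulrBr opprD [LHS]addrACA.
split.
- split=> // d a u v; rewrite cdo_bracketC lr opprD -scalerN.
  by rewrite -!(cdo_bracketC _ d).
- move=> c; apply: sec_ext => p; apply: cdo_ext => [u|] /=.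
    by rewrite subrr.
  by apply: tan_ext => f /=; rewrite subrr.
move=> b c d; apply: sec_ext => p; apply: cdo_ext => [u|].
  by rewrite /= !cdo_app_bracket !cdo_opB; exact: jacobi_cancel.
apply: tan_ext => f; rewrite /= !cdo_anchor_bracket !vf_app_bracket !tanB.
exact: jacobi_cancel.
Qed.

Program Definition cdo_algebroid : lieAlgebroid (cdoBundle E) :=
  @LieAlgebroid R M (cdoBundle E) cdo_bracket (cdo_anchor E) cdo_bracketP _.
Next Obligation.
move=> c f d; apply: sec_ext => p; apply: cdo_ext => [u|] /=.
  rewrite (_ : cdo_app (f *^ d) u = f *^ cdo_app d u); last exact: sec_ext.
  by rewrite cdo_leibniz /= scalerBr addrAC.
apply: tan_ext => g /=.
rewrite (_ : vf_app (cdo_anchor E (f *^ d)) g = f * vf_app (cdo_anchor E d) g);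
  last exact: cinf_ext.
by rewrite tan_leibniz /=; ring.
Qed.

End CdoBracket.

Definition is_representation (R : realType) (M : smoothManifold R)
    (A E : vectorBundle M) (LA : lieAlgebroid A)
    (rho : bundleMap A (cdoBundle E)) : Prop :=
  lie_hom LA (cdo_algebroid E) rho.

Definition is_O_operator (R : realType) (M : smoothManifold R)
    (A E : vectorBundle M) (LA : lieAlgebroid A)
    (rho : bundleMap A (cdoBundle E)) (T : bundleMap E A) : Prop :=
  forall u v : section E,
    lie_bracket LA (T u) (T v) =
    T (cdo_app (rho (T u)) v - cdo_app (rho (T v)) u).

(* Main.v *)
Require Import Defs.
From HB Require Import structures.
From mathcomp Require Import all_boot all_order all_algebra.
From mathcomp Require Import all_classical all_reals.
From mathcomp Require Import topology normedtype derive.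

Set Implicit Arguments.
Unset Strict Implicit.
Unset Printing Implicit Defensive.

Import GRing.Theory.
Local Open Scope ring_scope.

(** The [O]-operator identity says that [T] carries the commutator of the product to the bracket of
    [A]. Applying the bracket-preserving [rho] makes left multiplication turn commutators into
    commutators ([O_mul_commutator]), which is left symmetry rearranged. The Leibniz rule holds
    because each [rho (T u)] is a covariant differential operator, and linearity over functions in
    the first argument because [rho] and [T] are bundle maps. *)

Lemma cdo_app_linearl (R : realType) (M : smoothManifold R)
    (E : smoothFamily M) (u : section E) :
  linear (fun d : section (cdoBundle E) => cdo_app d u).
Proof. by move=> a c d; apply: sec_ext. Qed.

Lemma cdo_app_fscalel (R : realType) (M : smoothManifold R)
    (E : smoothFamily M) (f : Cinf M) (d : section (cdoBundle E))
    (u : section E) :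
  cdo_app (f *^ d) u = f *^ cdo_app d u.
Proof. exact: sec_ext. Qed.

Section OOperator.
Context {R : realType} {M : smoothManifold R} {A E : vectorBundle M}.
Context {LA : lieAlgebroid A} {rho : bundleMap A (cdoBundle E)}.
Context (hrho : is_representation LA rho).
Context {T : bundleMap E A} (hT : is_O_operator LA rho T).

Definition O_mul (u v : section E) : section E := cdo_app (rho (T u)) v.

Lemma O_mul_bilinear : bilinear_op O_mul.
Proof.
split=> [u|v] a x y; first exact: cdo_app_linear.
by rewrite /O_mul !bm_sec_linear cdo_app_linearl.
Qed.

(* The O-operator identity reads [T u, T v] = T (u v - v u); applying rho, the
   commutator of left multiplications is left multiplication by u v - v u. *)
Lemma O_mul_commutator (u v w : section E) :
  O_mul (O_mul u v - O_mul v u) w =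
  O_mul u (O_mul v w) - O_mul v (O_mul u w).
Proof. by rewrite {1}/O_mul -hT hrho.2 cdo_app_bracket. Qed.

Lemma O_mul_left_symmetric : left_symmetric_law O_mul.
Proof.
split=> [|u v w]; first exact: O_mul_bilinear.
have := O_mul_commutator u v w.
have -> : O_mul (O_mul u v - O_mul v u) w =
          O_mul (O_mul u v) w - O_mul (O_mul v u) w.
  (* [linear] is stated for [a *: x + y], so the difference is rewritten with [a = -1]. *)
  by rewrite addrC -scaleN1r O_mul_bilinear.2 scaleN1r addrC.
move/eqP; rewrite subr_eq => /eqP ->.
by rewrite [LHS](ACl (1*4*3*2)) /= subrr add0r.
Qed.

(** The symbol of [rho (T u)] is the anchor of [T u], since [rho] preserves anchors. *)
Lemma O_mul_leibniz (u : section E) (f : Cinf M) (v : section E) :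
  O_mul u (f *^ v) =
  f *^ O_mul u v + vf_app (bm_comp (lie_anchor LA) T u) f *^ v.
Proof.
rewrite /O_mul cdo_app_leibniz; congr (_ + vf_app _ f *^ v).
by apply: sec_ext => p; exact: hrho.1.
Qed.

Lemma O_mul_fscalel (f : Cinf M) (u v : section E) :
  O_mul (f *^ u) v = f *^ O_mul u v.
Proof. by rewrite /O_mul !bm_sec_fscale cdo_app_fscalel. Qed.

Definition O_algebroid : leftSymmetricAlgebroid E :=
  LeftSymmetricAlgebroid O_mul_left_symmetric O_mul_leibniz O_mul_fscalel.

End OOperator.

Theorem proposition3p9 (R : realType) (M : smoothManifold R)
    (A E : vectorBundle M) (LA : lieAlgebroid A)
    (rho : bundleMap A (cdoBundle E)) (hrho : is_representation LA rho)
    (T : bundleMap E A) (hT : is_O_operator LA rho T) :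
  exists LE : leftSymmetricAlgebroid E,
    (forall u v : section E, ls_mul LE u v = cdo_app (rho (T u)) v) /\
    ls_anchor LE = bm_comp (lie_anchor LA) T /\
    lie_hom (sub_adjacent LE) LA T.
Proof.
(* Anchors agree by construction; bracket preservation is the [O]-operator identity itself. *)
exists (O_algebroid hrho hT); split=> //; split=> //; split=> [//|u v].
by rewrite hT.
Qed.
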